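(* In any model of MTT over the walking adjunction $\mathcal{M}_{adj}$, the interpretations of the locks satisfy $[\![\nu]\!] \dashv [\![\mu]\!]$. Moreover, if $[\![\mu]\!]\dashv R_\mu$ and $[\![\nu]\!]\dashv R_\nu$ are adjunctions and the modal type formers $\langle\mu\mid-\rangle$ and $\langle\nu\mid-\rangle$ are interpreted by the dependent right adjoints obtained by lifting the right adjoints $R_\mu$ and $R_\nu$ to types and terms, then $R_\nu \dashv R_\mu$.
   Context: The walking adjunction $\mathcal{M}_{adj}$ is the 2-category freely generated by modes $m,n$, 1-cells $\nu: m\to n$, $\mu : n\to m$ and 2-cells $\eta : 1_m\Rightarrow\mu\circ\nu$, $\epsilon:\nu\circ\mu\Rightarrow 1_n$ satisfying the triangle identities. MTT over a mode theory is the dependent type theory with locks $\Gamma.\{\xi\}$ on contexts for each modality $\xi$ (from the codomain mode of $\xi$ to its domain mode), key substitutions for 2-cells, modal types $\langle\xi\mid A\rangle$ with introduction and pattern-matching elimination, plus $\Pi,\Sigma$, Id, Bool and a universe at each mode. A model of MTT over $\mathcal{M}$ consists in particular of a strict 2-functor $[\![-]\!] : \mathcal{M}^{\mathrm{coop}}\to\mathbf{CAT}$ (reversing 1- and 2-cells) sending each mode to a context category and each modality $\xi$ to the functor $[\![\xi]\!]$ interpreting its lock, together with natural models at each mode supporting all type formers. A right adjoint $R$ of a lock functor $L$ that extends to a weak morphism of natural models (acting on types and terms compatibly with context extension up to isomorphism) lifts to a dependent right adjoint structure on $L$, i.e. natural transformations on types and terms forming a pullback square over the natural models, which can interpret $\langle\xi\mid-\rangle$.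 *)

(* Defs.v *)
From Stdlib Require Import ssreflect ssrfun.
From Stdlib Require Import FunctionalExtensionality PropExtensionality.
From Stdlib Require Import ProofIrrelevance ClassicalEpsilon.

Set Implicit Arguments.
Unset Strict Implicit.
Unset Printing Implicit Defensive.

Declare Scope cat_scope.
Delimit Scope cat_scope with cat.
Local Open Scope cat_scope.

Record category := Category {
  ob :> Type;
  hom : ob -> ob -> Type;
  idc : forall a, hom a a;
  comp : forall a b c, hom b c -> hom a b -> hom a c;
  comp1c : forall a b (f : hom a b), comp (idc b) f = f;
  compc1 : forall a b (f : hom a b), comp f (idc a) = f;
  compA : forall a b c d (h : hom c d) (g : hom b c) (f : hom a b),
    comp h (comp g f) = comp (comp h g) f
}.
Arguments idc {C} a : rename.
Arguments hom {C} a b : rename.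
Arguments comp {C a b c} g f : rename.
Notation "g ∘ f" := (comp g f) (at level 40, left associativity) : cat_scope.

Definition op_category (C : category) : category :=
  @Category C (fun a b => @hom C b a) (fun a => idc a)
    (fun a b c g f => f ∘ g)
    (fun a b f => compc1 f) (fun a b f => comp1c f)
    (fun a b c d h g f => esym (compA f g h)).

Definition hom_of_eq (C : category) (a b : C) (e : a = b) : hom a b :=
  match e in _ = b0 return hom a b0 with erefl => idc a end.

Definition is_iso (C : category) (a b : C) (f : hom a b) : Prop :=
  exists g : hom b a, g ∘ f = idc a /\ f ∘ g = idc b.

Record terminal_object (C : category) := TerminalObject {
  terminal :> C;
  to_terminal : forall a, hom a terminal;
  to_terminal_unique : forall a (f : hom a terminal), f = to_terminal a
}.

Record functor (C D : category) := Functor {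
  fob :> C -> D;
  fmor : forall a b, hom a b -> hom (fob a) (fob b);
  fmor_id : forall a, fmor (idc a) = idc (fob a);
  fmor_comp : forall a b c (g : hom b c) (f : hom a b),
    fmor (g ∘ f) = fmor g ∘ fmor f
}.
Arguments fmor {C D} F {a b} f : rename.

Record nattrans (C D : category) (F G : functor C D) := Nattrans {
  ncomp :> forall a, hom (F a) (G a);
  natural : forall a b (f : hom a b), fmor G f ∘ ncomp a = ncomp b ∘ fmor F f
}.

Definition functor_id (C : category) : functor C C :=
  @Functor C C (fun a => a) (fun a b f => f)
    (fun a => erefl) (fun a b c g f => erefl).

Definition functor_comp (C D E : category) (G : functor D E) (F : functor C D) :
  functor C E.
Proof.
refine (@Functor C E (fun a => G (F a)) (fun a b f => fmor G (fmor F f)) _ _).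
- by move=> a; rewrite !fmor_id.
- by move=> a b c g f; rewrite !fmor_comp.
Defined.

Definition functor_op (C D : category) (F : functor C D) :
  functor (op_category C) (op_category D) :=
  @Functor (op_category C) (op_category D) (fun a => F a) (fun a b f => fmor F f)
    (fun a => fmor_id F a) (fun a b c g f => fmor_comp F f g).

Lemma nattrans_eq (C D : category) (F G : functor C D) (s t : nattrans F G) :
  (forall a, s a = t a) -> s = t.
Proof.
case: s => s sn; case: t => t tn /= st.
have e : s = t by apply: functional_extensionality_dep.
by case: t / e tn {st} => tn; rewrite (proof_irrelevance _ sn tn).
Qed.

Lemma functor_eq (C D : category) (F G : functor C D) (e : fob F = fob G) :
  (forall a b (f : hom a b),
     hom_of_eq (f_equal (fun H => H b) e) ∘ fmor F f
     = fmor G f ∘ hom_of_eq (f_equal (fun H => H a) e)) -> F = G.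
Proof.
case: F e => F Fm F1 FM; case: G => G Gm G1 GM /= e.
case: G / e Gm G1 GM => Gm G1 GM /= FG.
have e : Fm = Gm.
  apply: functional_extensionality_dep => a.
  apply: functional_extensionality_dep => b.
  apply: functional_extensionality_dep => f.
  by have := FG a b f; rewrite comp1c compc1.
case: Gm / e G1 GM {FG} => G1 GM.
by rewrite (proof_irrelevance _ F1 G1) (proof_irrelevance _ FM GM).
Qed.

Definition nt_id (C D : category) (F : functor C D) : nattrans F F.
Proof.
refine (@Nattrans C D F F (fun a => idc (F a)) _).
by move=> a b f; rewrite comp1c compc1.
Defined.

Definition nt_comp (C D : category) (F G H : functor C D)
  (t : nattrans G H) (s : nattrans F G) : nattrans F H.
Proof.
refine (@Nattrans C D F H (fun a => t a ∘ s a) _).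
by move=> a b f; rewrite compA natural -compA natural compA.
Defined.

Definition functor_category (C D : category) : category.
Proof.
refine (@Category (functor C D) (@nattrans C D) (@nt_id C D) (@nt_comp C D) _ _ _).
- by move=> F G s; apply: nattrans_eq => a /=; rewrite comp1c.
- by move=> F G s; apply: nattrans_eq => a /=; rewrite compc1.
- by move=> F G H K u t s; apply: nattrans_eq => a /=; rewrite compA.
Defined.

Definition nt_hcomp (C D E : category) (G G' : functor D E) (F F' : functor C D)
  (t : nattrans G G') (s : nattrans F F') :
  nattrans (functor_comp G F) (functor_comp G' F').
Proof.
refine (@Nattrans C E (functor_comp G F) (functor_comp G' F')
          (fun a => t (F' a) ∘ fmor G (s a)) _).
move=> a b f /=.
by rewrite compA natural -!compA -!fmor_comp natural.
Defined.

Record adjunction (C D : category) (L : functor C D) (R : functor D C) := Adjunction {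
  adj_unit : nattrans (functor_id C) (functor_comp R L);
  adj_counit : nattrans (functor_comp L R) (functor_id D);
  triangle_left : forall c, adj_counit (L c) ∘ fmor L (adj_unit c) = idc (L c);
  triangle_right : forall d, fmor R (adj_counit d) ∘ adj_unit (R d) = idc (R d)
}.

(* [comp1] is composition of 1-cells and [hcomp] is horizontal composition of
   2-cells; vertical composition is composition in the hom-categories.  Since
   [comp1] is only propositionally associative and unital, the strict laws for
   2-cells are stated up to the identity 2-cells [hom_of_eq _]. *)
Record two_category := TwoCategory {
  cell0 :> Type;
  Hom : cell0 -> cell0 -> category;
  id1 : forall a, Hom a a;
  comp1 : forall a b c, Hom b c -> Hom a b -> Hom a c;
  hcomp : forall a b c (g g' : Hom b c) (f f' : Hom a b),
    hom g g' -> hom f f' -> hom (comp1 g f) (comp1 g' f');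
  hcomp_id : forall a b c (g : Hom b c) (f : Hom a b),
    hcomp (idc g) (idc f) = idc (comp1 g f);
  hcomp_comp : forall a b c (g g' g'' : Hom b c) (f f' f'' : Hom a b)
      (t' : hom g' g'') (t : hom g g') (s' : hom f' f'') (s : hom f f'),
    hcomp (t' ∘ t) (s' ∘ s) = hcomp t' s' ∘ hcomp t s;
  comp1_1c : forall a b (f : Hom a b), comp1 (id1 b) f = f;
  comp1_c1 : forall a b (f : Hom a b), comp1 f (id1 a) = f;
  comp1A : forall a b c d (h : Hom c d) (g : Hom b c) (f : Hom a b),
    comp1 h (comp1 g f) = comp1 (comp1 h g) f;
  hcomp_1c : forall a b (f f' : Hom a b) (s : hom f f'),
    hom_of_eq (comp1_1c f') ∘ hcomp (idc (id1 b)) s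
    = s ∘ hom_of_eq (comp1_1c f);
  hcomp_c1 : forall a b (f f' : Hom a b) (s : hom f f'),
    hom_of_eq (comp1_c1 f') ∘ hcomp s (idc (id1 a))
    = s ∘ hom_of_eq (comp1_c1 f);
  hcompA : forall a b c d (h h' : Hom c d) (g g' : Hom b c) (f f' : Hom a b)
      (u : hom h h') (t : hom g g') (s : hom f f'),
    hom_of_eq (comp1A h' g' f') ∘ hcomp u (hcomp t s)
    = hcomp (hcomp u t) s ∘ hom_of_eq (comp1A h g f)
}.
Arguments Hom {t} a b : rename.
Arguments id1 {t} a : rename.
Arguments comp1 {t a b c} g f : rename.
Arguments hcomp {t a b c g g' f f'} u s : rename.
Notation "g ⊚ f" := (comp1 g f) (at level 40, left associativity) : cat_scope.

Record strict_functor (M N : two_category) := StrictFunctor {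
  sf0 :> M -> N;
  sf1 : forall a b, functor (Hom a b) (Hom (sf0 a) (sf0 b));
  sf_id1 : forall a, sf1 a a (id1 a) = id1 (sf0 a);
  sf_comp1 : forall a b c (g : Hom b c) (f : Hom a b),
    sf1 a c (g ⊚ f) = sf1 b c g ⊚ sf1 a b f;
  sf_hcomp : forall a b c (g g' : Hom b c) (f f' : Hom a b)
      (t : hom g g') (s : hom f f'),
    hom_of_eq (sf_comp1 g' f') ∘ fmor (sf1 a c) (hcomp t s)
    = hcomp (fmor (sf1 b c) t) (fmor (sf1 a b) s) ∘ hom_of_eq (sf_comp1 g f)
}.
Arguments sf1 {M N} F {a b} : rename.
Arguments sf_id1 {M N} F a : rename.
Arguments sf_comp1 {M N} F {a b c} g f : rename.

Lemma hom_of_eq_op (C : category) (a b : C) (e : a = b) :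
  @hom_of_eq (op_category C) a b e = hom_of_eq (esym e).
Proof. by case: b / e. Qed.

Lemma hom_of_eq_flip (C : category) (a a' b b' : C) (e : a = b) (e' : a' = b')
    (u : hom a a') (v : hom b b') :
  hom_of_eq e' ∘ u = v ∘ hom_of_eq e ->
  u ∘ hom_of_eq (esym e) = hom_of_eq (esym e') ∘ v.
Proof. by case: b / e v; case: b' / e' => v /=; rewrite !comp1c !compc1. Qed.

Definition coop (M : two_category) : two_category.
Proof.
refine (@TwoCategory M (fun a b => op_category (@Hom M b a)) (fun a => id1 a)
  (fun a b c g f => @comp1 M c b a f g)
  (fun a b c g g' f f' t s => @hcomp M c b a f' f g' g s t) _ _
  (fun a b f => comp1_c1 f) (fun a b f => comp1_1c f)
  (fun a b c d h g f => esym (comp1A f g h)) _ _ _).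
- by move=> a b c g f /=; rewrite hcomp_id.
- by move=> a b c g g' g'' f f' f'' t' t s' s /=; rewrite hcomp_comp.
- move=> a b f f' s; rewrite !hom_of_eq_op /=.
  exact: hom_of_eq_flip (hcomp_c1 s).
- move=> a b f f' s; rewrite !hom_of_eq_op /=.
  exact: hom_of_eq_flip (hcomp_1c s).
- move=> a b c d h h' g g' f f' u t s; rewrite !hom_of_eq_op /=.
  rewrite (proof_irrelevance _ (esym (esym (comp1A f g h))) (comp1A f g h)).
  rewrite (proof_irrelevance _ (esym (esym (comp1A f' g' h'))) (comp1A f' g' h')).
  by rewrite hcompA.
Defined.

Lemma ncomp_hom_of_eq (C D : category) (F G : functor C D) (e : F = G) (a : C) :
  ncomp (@hom_of_eq (functor_category C D) F G e) a
  = hom_of_eq (f_equal (fun H : functor C D => H a) e).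
Proof. by case: G / e. Qed.

Lemma hom_of_eq_id (C : category) (a : C) (e : a = a) : hom_of_eq e = idc a.
Proof. by rewrite (proof_irrelevance _ e erefl). Qed.

Lemma functor_comp_1f (C D : category) (F : functor C D) :
  functor_comp (functor_id D) F = F.
Proof.
refine (@functor_eq C D (functor_comp (functor_id D) F) F erefl _).
by move=> a b f /=; rewrite comp1c compc1.
Qed.

Lemma functor_comp_f1 (C D : category) (F : functor C D) :
  functor_comp F (functor_id C) = F.
Proof.
refine (@functor_eq C D (functor_comp F (functor_id C)) F erefl _).
by move=> a b f /=; rewrite comp1c compc1.
Qed.

Lemma functor_compA (B C D E : category)
    (H : functor D E) (G : functor C D) (F : functor B C) :
  functor_comp H (functor_comp G F) = functor_comp (functor_comp H G) F.
Proof.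
refine (@functor_eq B E (functor_comp H (functor_comp G F))
          (functor_comp (functor_comp H G) F) erefl _).
by move=> a b f /=; rewrite comp1c compc1.
Qed.

Definition CAT : two_category.
Proof.
refine (@TwoCategory category functor_category functor_id functor_comp nt_hcomp
  _ _ functor_comp_1f functor_comp_f1 functor_compA _ _ _).
- by move=> a b c g f; apply: nattrans_eq => x /=; rewrite fmor_id comp1c.
- move=> a b c g g' g'' f f' f'' t' t s' s; apply: nattrans_eq => x /=.
  by rewrite fmor_comp !compA -(compA (t' _)) -natural compA.
- move=> a b f f' s; apply: nattrans_eq => x /=.
  by rewrite !ncomp_hom_of_eq !hom_of_eq_id !comp1c compc1.
- move=> a b f f' s; apply: nattrans_eq => x /=.
  by rewrite !ncomp_hom_of_eq !hom_of_eq_id !comp1c compc1 fmor_id compc1.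
- move=> a b c d h h' g g' f f' u t s; apply: nattrans_eq => x /=.
  by rewrite !ncomp_hom_of_eq !hom_of_eq_id !comp1c !compc1 fmor_comp compA.
Defined.

Definition quotient (T : Type) (R : T -> T -> Prop) : Type :=
  {P : T -> Prop | exists t, P = R t}.

Definition class (T : Type) (R : T -> T -> Prop) (t : T) : quotient R :=
  exist _ (R t) (ex_intro _ t erefl).

Definition repr (T : Type) (R : T -> T -> Prop) (x : quotient R) : T :=
  proj1_sig (constructive_indefinite_description _ (proj2_sig x)).

Lemma repr_class (T : Type) (R : T -> T -> Prop) (x : quotient R) :
  class R (repr x) = x.
Proof.
rewrite /repr; case: constructive_indefinite_description => t /=.
by case: x => P H /= e; apply: subset_eq_compat; rewrite e.
Qed.

Inductive adj_mode : Type := mode_m | mode_n.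

Inductive adj_generator : adj_mode -> adj_mode -> Type :=
| gen_nu : adj_generator mode_m mode_n
| gen_mu : adj_generator mode_n mode_m.

(* 1-cells: the free category on the generators; [adj_cons g p] is [g ∘ p]. *)
Inductive adj_path (a : adj_mode) : adj_mode -> Type :=
| adj_nil : adj_path a a
| adj_cons b c : adj_generator b c -> adj_path a b -> adj_path a c.
Arguments adj_nil {a}.

Fixpoint adj_cat (a b c : adj_mode) (q : adj_path b c) (p : adj_path a b) :
  adj_path a c :=
  match q with
  | adj_nil => p
  | adj_cons g q' => adj_cons g (adj_cat q' p)
  end.

Lemma adj_cat_nil (a b : adj_mode) (p : adj_path a b) : adj_cat p adj_nil = p.
Proof. by elim: p => //= c d g p ->. Qed.

Lemma adj_catA (a b c d : adj_mode)
    (r : adj_path c d) (q : adj_path b c) (p : adj_path a b) :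
  adj_cat r (adj_cat q p) = adj_cat (adj_cat r q) p.
Proof. by elim: r q => //= c' d' g r IH q; rewrite IH. Qed.

Definition path_nu : adj_path mode_m mode_n := adj_cons gen_nu adj_nil.
Definition path_mu : adj_path mode_n mode_m := adj_cons gen_mu adj_nil.

(* 2-cells: formal composites of the generators [eta] and [epsilon], modulo the
   least congruence containing the strict 2-category laws and the triangle
   identities. *)
Inductive adj_term : forall a b, adj_path a b -> adj_path a b -> Type :=
| adj_id a b (p : adj_path a b) : adj_term p p
| adj_vcomp a b (p q r : adj_path a b) :
    adj_term q r -> adj_term p q -> adj_term p r
| adj_hcomp a b c (q q' : adj_path b c) (p p' : adj_path a b) :
    adj_term q q' -> adj_term p p' -> adj_term (adj_cat q p) (adj_cat q' p')
| adj_eta : adj_term adj_nil (adj_cat path_mu path_nu)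
| adj_epsilon : adj_term (adj_cat path_nu path_mu) adj_nil.

Definition adj_cast (a b : adj_mode) (p q : adj_path a b) (e : p = q) :
  adj_term p q :=
  match e in _ = q0 return adj_term p q0 with erefl => adj_id p end.

Inductive adj_eqv :
  forall a b (p q : adj_path a b), adj_term p q -> adj_term p q -> Prop :=
| eqv_refl a b (p q : adj_path a b) (s : adj_term p q) : adj_eqv s s
| eqv_sym a b (p q : adj_path a b) (s t : adj_term p q) :
    adj_eqv s t -> adj_eqv t s
| eqv_trans a b (p q : adj_path a b) (s t u : adj_term p q) :
    adj_eqv s t -> adj_eqv t u -> adj_eqv s u
| eqv_vcomp a b (p q r : adj_path a b)
      (t t' : adj_term q r) (s s' : adj_term p q) :
    adj_eqv t t' -> adj_eqv s s' -> adj_eqv (adj_vcomp t s) (adj_vcomp t' s')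
| eqv_hcomp a b c (q q' : adj_path b c) (p p' : adj_path a b)
      (t t' : adj_term q q') (s s' : adj_term p p') :
    adj_eqv t t' -> adj_eqv s s' -> adj_eqv (adj_hcomp t s) (adj_hcomp t' s')
| eqv_1c a b (p q : adj_path a b) (s : adj_term p q) :
    adj_eqv (adj_vcomp (adj_id q) s) s
| eqv_c1 a b (p q : adj_path a b) (s : adj_term p q) :
    adj_eqv (adj_vcomp s (adj_id p)) s
| eqv_vcompA a b (p q r x : adj_path a b)
      (u : adj_term r x) (t : adj_term q r) (s : adj_term p q) :
    adj_eqv (adj_vcomp u (adj_vcomp t s)) (adj_vcomp (adj_vcomp u t) s)
| eqv_hcomp_id a b c (q : adj_path b c) (p : adj_path a b) :
    adj_eqv (adj_hcomp (adj_id q) (adj_id p)) (adj_id (adj_cat q p))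
| eqv_hcomp_comp a b c (q q' q'' : adj_path b c) (p p' p'' : adj_path a b)
      (t' : adj_term q' q'') (t : adj_term q q')
      (s' : adj_term p' p'') (s : adj_term p p') :
    adj_eqv (adj_hcomp (adj_vcomp t' t) (adj_vcomp s' s))
            (adj_vcomp (adj_hcomp t' s') (adj_hcomp t s))
| eqv_hcomp_1c a b (p p' : adj_path a b) (s : adj_term p p') :
    adj_eqv (adj_hcomp (adj_id adj_nil) s) s
| eqv_hcomp_c1 a b (p p' : adj_path a b) (s : adj_term p p') :
    adj_eqv
      (adj_vcomp (adj_cast (adj_cat_nil p')) (adj_hcomp s (adj_id adj_nil)))
      (adj_vcomp s (adj_cast (adj_cat_nil p)))
| eqv_hcompA a b c d (r r' : adj_path c d) (q q' : adj_path b c)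
      (p p' : adj_path a b)
      (u : adj_term r r') (t : adj_term q q') (s : adj_term p p') :
    adj_eqv
      (adj_vcomp (adj_cast (adj_catA r' q' p')) (adj_hcomp u (adj_hcomp t s)))
      (adj_vcomp (adj_hcomp (adj_hcomp u t) s) (adj_cast (adj_catA r q p)))
(* Both triangles typecheck without casts: the bracketings of each composite
   of the closed paths [path_nu] and [path_mu] compute to the same path. *)
| eqv_triangle_nu :
    @adj_eqv mode_m mode_n path_nu path_nu
      (adj_vcomp (adj_hcomp adj_epsilon (adj_id path_nu))
                 (adj_hcomp (adj_id path_nu) adj_eta))
      (adj_id path_nu)
| eqv_triangle_mu :
    @adj_eqv mode_n mode_m path_mu path_mu
      (adj_vcomp (adj_hcomp (adj_id path_mu) adj_epsilon)
                 (adj_hcomp adj_eta (adj_id path_mu)))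
      (adj_id path_mu).

Definition adj_cell (a b : adj_mode) (p q : adj_path a b) : Type :=
  quotient (@adj_eqv a b p q).

Definition adj_class (a b : adj_mode) (p q : adj_path a b) (s : adj_term p q) :
  adj_cell p q := class (@adj_eqv a b p q) s.

Lemma adj_class_eq (a b : adj_mode) (p q : adj_path a b) (s t : adj_term p q) :
  adj_eqv s t -> adj_class s = adj_class t.
Proof.
move=> st; apply: subset_eq_compat.
apply: functional_extensionality => u; apply: propositional_extensionality.
split=> [su|tu]; last exact: eqv_trans st tu.
exact: eqv_trans (eqv_sym st) su.
Qed.

Lemma adj_repr_class (a b : adj_mode) (p q : adj_path a b) (s : adj_term p q) :
  adj_eqv (repr (adj_class s)) s.
Proof.
have := repr_class (adj_class s); set t := repr _ => /(f_equal (@proj1_sig _ _)).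
by move=> /= ->; exact: eqv_refl.
Qed.

Definition adj_cell_id (a b : adj_mode) (p : adj_path a b) : adj_cell p p :=
  adj_class (adj_id p).

Definition adj_cell_vcomp (a b : adj_mode) (p q r : adj_path a b)
  (t : adj_cell q r) (s : adj_cell p q) : adj_cell p r :=
  adj_class (adj_vcomp (repr t) (repr s)).

Definition adj_cell_hcomp (a b c : adj_mode)
  (q q' : adj_path b c) (p p' : adj_path a b)
  (t : adj_cell q q') (s : adj_cell p p') :
  adj_cell (adj_cat q p) (adj_cat q' p') :=
  adj_class (adj_hcomp (repr t) (repr s)).

Lemma adj_vcomp_class (a b : adj_mode) (p q r : adj_path a b)
    (t : adj_term q r) (s : adj_term p q) :
  adj_cell_vcomp (adj_class t) (adj_class s) = adj_class (adj_vcomp t s).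
Proof. by apply: adj_class_eq; apply: eqv_vcomp; apply: adj_repr_class. Qed.

Lemma adj_hcomp_class (a b c : adj_mode)
    (q q' : adj_path b c) (p p' : adj_path a b)
    (t : adj_term q q') (s : adj_term p p') :
  adj_cell_hcomp (adj_class t) (adj_class s) = adj_class (adj_hcomp t s).
Proof. by apply: adj_class_eq; apply: eqv_hcomp; apply: adj_repr_class. Qed.

Lemma adj_cell_ind (a b : adj_mode) (p q : adj_path a b)
    (P : adj_cell p q -> Prop) :
  (forall s : adj_term p q, P (adj_class s)) -> forall x, P x.
Proof. by move=> H x; rewrite -(repr_class x); apply: H. Qed.

Definition adj_hom (a b : adj_mode) : category.
Proof.
refine (@Category (adj_path a b) (@adj_cell a b) (@adj_cell_id a b)
          (@adj_cell_vcomp a b) _ _ _).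
- move=> p q; elim/adj_cell_ind => s; rewrite adj_vcomp_class.
  exact: adj_class_eq (eqv_1c s).
- move=> p q; elim/adj_cell_ind => s; rewrite adj_vcomp_class.
  exact: adj_class_eq (eqv_c1 s).
- move=> p q r x; elim/adj_cell_ind => u; elim/adj_cell_ind => t.
  elim/adj_cell_ind => s; rewrite !adj_vcomp_class.
  exact: adj_class_eq (eqv_vcompA u t s).
Defined.

Lemma adj_hom_of_eq (a b : adj_mode) (p q : adj_path a b) (e : p = q) :
  @hom_of_eq (adj_hom a b) p q e = adj_class (adj_cast e).
Proof. by case: q / e. Qed.

Definition walking_adjunction : two_category.
Proof.
refine (@TwoCategory adj_mode adj_hom (fun a => @adj_nil a) adj_cat
  adj_cell_hcomp _ _ (fun a b p => erefl) adj_cat_nil adj_catA _ _ _).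
- move=> a b c q p; rewrite /= adj_hcomp_class.
  exact: adj_class_eq (eqv_hcomp_id q p).
- move=> a b c q q' q'' p p' p''; elim/adj_cell_ind => t'.
  elim/adj_cell_ind => t; elim/adj_cell_ind => s'; elim/adj_cell_ind => s /=.
  rewrite (adj_vcomp_class t' t) (adj_vcomp_class s' s) !adj_hcomp_class.
  rewrite (adj_vcomp_class (adj_hcomp t' s') (adj_hcomp t s)).
  exact: adj_class_eq (eqv_hcomp_comp t' t s' s).
- move=> a b p p'; elim/adj_cell_ind => s /=.
  rewrite adj_hcomp_class !adj_vcomp_class; apply: adj_class_eq.
  apply: eqv_trans (eqv_sym (eqv_c1 s)).
  exact: eqv_trans (eqv_1c _) (eqv_hcomp_1c s).
- move=> a b p p'; elim/adj_cell_ind => s /=; rewrite !adj_hom_of_eq.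
  rewrite adj_hcomp_class !adj_vcomp_class.
  exact: adj_class_eq (eqv_hcomp_c1 s).
- move=> a b c d r r' q q' p p'; elim/adj_cell_ind => u.
  elim/adj_cell_ind => t; elim/adj_cell_ind => s /=; rewrite !adj_hom_of_eq.
  rewrite !adj_hcomp_class !adj_vcomp_class.
  exact: adj_class_eq (eqv_hcompA u t s).
Defined.

Definition adj_nu : @Hom walking_adjunction mode_m mode_n := path_nu.
Definition adj_mu : @Hom walking_adjunction mode_n mode_m := path_mu.

Definition SET : category.
Proof.
by refine (@Category Type (fun A B => A -> B) (fun A x => x)
             (fun A B C g f x => g (f x)) _ _ _).
Defined.

Definition presheaf (C : category) : Type := functor (op_category C) SET.

Definition elt (C : category) (P : presheaf C) (Γ : C) : Type := fob P Γ.

Definition subst (C : category) (P : presheaf C) (Δ Γ : C)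
  (x : elt P Γ) (σ : hom Δ Γ) : elt P Δ := @fmor _ _ P Γ Δ σ x.
Notation "x .[ σ ]" := (subst x σ)
  (at level 2, left associativity, format "x .[ σ ]") : cat_scope.

Definition papp (C : category) (P Q : presheaf C) (t : nattrans P Q)
  (Γ : C) (x : elt P Γ) : elt Q Γ := ncomp t Γ x.
Arguments papp {C P Q} t {Γ} x.
Notation "t $ x" := (papp t x) (at level 20, right associativity) : cat_scope.

Lemma subst_id (C : category) (P : presheaf C) (Γ : C) (x : elt P Γ) :
  x.[idc Γ] = x.
Proof. by rewrite /subst; have := @fmor_id _ _ P Γ; rewrite /= => ->. Qed.

Lemma subst_comp (C : category) (P : presheaf C) (Θ Δ Γ : C)
    (x : elt P Γ) (σ : hom Δ Γ) (τ : hom Θ Δ) : x.[σ].[τ] = x.[σ ∘ τ].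
Proof. by rewrite /subst; have := @fmor_comp _ _ P Γ Δ Θ τ σ; rewrite /= => ->. Qed.

Lemma papp_subst (C : category) (P Q : presheaf C) (t : nattrans P Q)
    (Δ Γ : C) (x : elt P Γ) (σ : hom Δ Γ) : t $ (x.[σ]) = (t $ x).[σ].
Proof.
exact: esym (f_equal (fun g => g x) (@natural _ _ _ _ t Γ Δ σ)).
Qed.

Definition reindex (C D : category) (L : functor C D) (P : presheaf D) :
  presheaf C := functor_comp P (functor_op L).

Definition reindex_nt (C D : category) (L : functor C D) (P Q : presheaf D)
  (t : nattrans P Q) : nattrans (reindex L P) (reindex L Q).
Proof.
refine (@Nattrans _ _ (reindex L P) (reindex L Q) (fun Γ => ncomp t (L Γ)) _).
by move=> Γ Δ σ; exact: (@natural _ _ _ _ t (L Γ) (L Δ) (fmor L σ)).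
Defined.

(* Chosen representability data for a natural transformation [f : X -> Y]:
   for every [y : Y Γ], a context [ext y] over [Γ] and an element of
   [X (ext y)] forming a pullback square with (the Yoneda transpose of) [y]. *)
Record representable (C : category) (X Y : presheaf C) (f : nattrans X Y) :=
Representable {
  ext : forall Γ, elt Y Γ -> C;
  proj : forall Γ (y : elt Y Γ), hom (ext y) Γ;
  var : forall Γ (y : elt Y Γ), elt X (ext y);
  var_ty : forall Γ (y : elt Y Γ), f $ var y = y.[proj y];
  pairing : forall Γ (y : elt Y Γ) Δ (σ : hom Δ Γ) (x : elt X Δ),
    f $ x = y.[σ] -> hom Δ (ext y);
  proj_pairing : forall Γ (y : elt Y Γ) Δ (σ : hom Δ Γ) (x : elt X Δ)
      (e : f $ x = y.[σ]), proj y ∘ pairing e = σ;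
  var_pairing : forall Γ (y : elt Y Γ) Δ (σ : hom Δ Γ) (x : elt X Δ)
      (e : f $ x = y.[σ]), (var y).[pairing e] = x;
  ext_inj : forall Γ (y : elt Y Γ) Δ (h h' : hom Δ (ext y)),
    proj y ∘ h = proj y ∘ h' -> (var y).[h] = (var y).[h'] -> h = h'
}.
Arguments ext {C X Y f} r {Γ} y : rename.
Arguments proj {C X Y f} r {Γ} y : rename.
Arguments var {C X Y f} r {Γ} y : rename.
Arguments var_ty {C X Y f} r {Γ} y : rename.
Arguments pairing {C X Y f} r {Γ y Δ σ x} e : rename.

Lemma inst_ty (C : category) (X Y : presheaf C) (f : nattrans X Y)
    (Γ : C) (y : elt Y Γ) (x : elt X Γ) :
  f $ x = y -> f $ x = y.[idc Γ].
Proof. by rewrite subst_id. Qed.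

(* The section [Γ -> Γ.A] given by a term of type [A]. *)
Definition inst (C : category) (X Y : presheaf C) (f : nattrans X Y)
  (r : representable f) (Γ : C) (y : elt Y Γ) (x : elt X Γ) (e : f $ x = y) :
  hom Γ (ext r y) := pairing r (inst_ty e).
Arguments inst {C X Y f} r {Γ y x} e.

Lemma lift_ty (C : category) (X Y : presheaf C) (f : nattrans X Y)
    (r : representable f) (Δ Γ : C) (σ : hom Δ Γ) (y : elt Y Γ)
    (y' : elt Y Δ) :
  y' = y.[σ] -> f $ var r y' = y.[σ ∘ proj r y'].
Proof. move=> e; rewrite var_ty -subst_comp.
by congr subst. Qed.

(* The morphism [Δ.A[σ] -> Γ.A] induced by [σ : Δ -> Γ], where the type over [Δ] is
   only required to be propositionally equal to [A[σ]]. *)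
Definition lift (C : category) (X Y : presheaf C) (f : nattrans X Y)
  (r : representable f) (Δ Γ : C) (σ : hom Δ Γ) (y : elt Y Γ) (y' : elt Y Δ)
  (e : y' = y.[σ]) : hom (ext r y') (ext r y) := pairing r (lift_ty r e).
Arguments lift {C X Y f} r {Δ Γ σ y y'} e.

Lemma proj_lift (C : category) (X Y : presheaf C) (f : nattrans X Y)
    (r : representable f) (Δ Γ : C) (σ : hom Δ Γ) (y : elt Y Γ) (y' : elt Y Δ)
    (e : y' = y.[σ]) : proj r y ∘ lift r e = σ ∘ proj r y'.
Proof. exact: proj_pairing. Qed.

Lemma var_lift (C : category) (X Y : presheaf C) (f : nattrans X Y)
    (r : representable f) (Δ Γ : C) (σ : hom Δ Γ) (y : elt Y Γ) (y' : elt Y Δ)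
    (e : y' = y.[σ]) : (var r y).[lift r e] = var r y'.
Proof. exact: var_pairing. Qed.

Lemma proj_inst (C : category) (X Y : presheaf C) (f : nattrans X Y)
    (r : representable f) (Γ : C) (y : elt Y Γ) (x : elt X Γ) (e : f $ x = y) :
  proj r y ∘ inst r e = idc Γ.
Proof. exact: proj_pairing. Qed.

Lemma var_inst (C : category) (X Y : presheaf C) (f : nattrans X Y)
    (r : representable f) (Γ : C) (y : elt Y Γ) (x : elt X Γ) (e : f $ x = y) :
  (var r y).[inst r e] = x.
Proof. exact: var_pairing. Qed.

Record natural_model (C : category) := NaturalModel {
  Ty : presheaf C;
  Tm : presheaf C;
  ty : nattrans Tm Ty;
  cext :> representable ty
}.

(* In the stability laws below, the typing hypotheses of the substituted
   instance are universally quantified; they are proof-irrelevant and follow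
   from those of the original instance. *)

(* Dependent products with domains classified by a representable [f : X -> Y]:
   a pullback square [P_f(Tm) -> Tm] over [P_f(Ty) -> Ty].  The pullback
   property packages application together with the beta and eta laws. *)
Record pi_structure (C : category) (X Y : presheaf C) (f : nattrans X Y)
  (r : representable f) (N : natural_model C) := PiStructure {
  Pi : forall Γ (A : elt Y Γ), elt (Ty N) (ext r A) -> elt (Ty N) Γ;
  lam : forall Γ (A : elt Y Γ), elt (Tm N) (ext r A) -> elt (Tm N) Γ;
  lam_ty : forall Γ (A : elt Y Γ) (b : elt (Tm N) (ext r A)),
    ty N $ lam b = Pi (ty N $ b);
  Pi_subst : forall Δ Γ (σ : hom Δ Γ) (A : elt Y Γ)
      (B : elt (Ty N) (ext r A)),
    (Pi B).[σ] = Pi B.[lift r (erefl A.[σ])];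
  lam_subst : forall Δ Γ (σ : hom Δ Γ) (A : elt Y Γ)
      (b : elt (Tm N) (ext r A)),
    (lam b).[σ] = lam b.[lift r (erefl A.[σ])];
  lam_pullback : forall Γ (A : elt Y Γ) (B : elt (Ty N) (ext r A))
      (c : elt (Tm N) Γ),
    ty N $ c = Pi B -> exists! b, ty N $ b = B /\ lam b = c
}.
Arguments Pi {C X Y f r N} p {Γ A} B : rename.

(* Dependent sums; the pullback property packages the two projections together
   with the beta and eta laws. *)
Record sigma_structure (C : category) (N : natural_model C) := SigmaStructure {
  Sigma : forall Γ (A : elt (Ty N) Γ), elt (Ty N) (ext N A) -> elt (Ty N) Γ;
  spair : forall Γ (A : elt (Ty N) Γ) (B : elt (Ty N) (ext N A))
      (a b : elt (Tm N) Γ) (Ha : ty N $ a = A)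
      (Hb : ty N $ b = B.[inst N Ha]), elt (Tm N) Γ;
  spair_ty : forall Γ (A : elt (Ty N) Γ) (B : elt (Ty N) (ext N A))
      (a b : elt (Tm N) Γ) (Ha : ty N $ a = A)
      (Hb : ty N $ b = B.[inst N Ha]), ty N $ spair Hb = Sigma B;
  Sigma_subst : forall Δ Γ (σ : hom Δ Γ) (A : elt (Ty N) Γ)
      (B : elt (Ty N) (ext N A)),
    (Sigma B).[σ] = Sigma B.[lift N (erefl A.[σ])];
  spair_subst : forall Δ Γ (σ : hom Δ Γ) (A : elt (Ty N) Γ)
      (B : elt (Ty N) (ext N A)) (a b : elt (Tm N) Γ) (Ha : ty N $ a = A)
      (Hb : ty N $ b = B.[inst N Ha]) (Ha' : ty N $ a.[σ] = A.[σ])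
      (Hb' : ty N $ b.[σ] = B.[lift N (erefl A.[σ])].[inst N Ha']),
    (spair Hb).[σ] = spair Hb';
  spair_pullback : forall Γ (A : elt (Ty N) Γ) (B : elt (Ty N) (ext N A))
      (c : elt (Tm N) Γ),
    ty N $ c = Sigma B ->
    exists! ab : elt (Tm N) Γ * elt (Tm N) Γ,
      exists (Ha : ty N $ ab.1 = A) (Hb : ty N $ ab.2 = B.[inst N Ha]),
        spair Hb = c
}.
Arguments Sigma {C N} s {Γ A} B : rename.

(* A family of context morphisms [inc i : dom i -> cod i], indexed by a
   presheaf and stable under substitution, against which an elimination
   principle (a stable choice of left liftings against [ty N]) is stated. *)
Record stable_family (C : category) := StableFamily {
  index : presheaf C;
  dom : forall Γ, elt index Γ -> C;
  cod : forall Γ, elt index Γ -> C;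
  inc : forall Γ (i : elt index Γ), hom (dom i) (cod i);
  dom_map : forall Δ Γ (σ : hom Δ Γ) (i : elt index Γ), hom (dom i.[σ]) (dom i);
  cod_map : forall Δ Γ (σ : hom Δ Γ) (i : elt index Γ), hom (cod i.[σ]) (cod i);
  inc_natural : forall Δ Γ (σ : hom Δ Γ) (i : elt index Γ),
    cod_map σ i ∘ inc i.[σ] = inc i ∘ dom_map σ i
}.

Record elim_structure (C : category) (S : stable_family C)
  (N : natural_model C) := ElimStructure {
  elim : forall Γ (i : elt (index S) Γ)
      (B : elt (Ty N) (cod i)) (d : elt (Tm N) (dom i)),
    ty N $ d = B.[inc i] -> elt (Tm N) (cod i);
  elim_ty : forall Γ (i : elt (index S) Γ)
      (B : elt (Ty N) (cod i)) (d : elt (Tm N) (dom i))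
      (H : ty N $ d = B.[inc i]), ty N $ elim H = B;
  elim_beta : forall Γ (i : elt (index S) Γ)
      (B : elt (Ty N) (cod i)) (d : elt (Tm N) (dom i))
      (H : ty N $ d = B.[inc i]), (elim H).[inc i] = d;
  elim_subst : forall Δ Γ (σ : hom Δ Γ) (i : elt (index S) Γ)
      (B : elt (Ty N) (cod i)) (d : elt (Tm N) (dom i))
      (H : ty N $ d = B.[inc i])
      (H' : ty N $ d.[dom_map σ i] = B.[cod_map σ i].[inc i.[σ]]),
    (elim H).[cod_map σ i] = elim H'
}.

Record id_former (C : category) (N : natural_model C) := IdFormer {
  Id : forall Γ (A : elt (Ty N) Γ) (a b : elt (Tm N) Γ),
    ty N $ a = A -> ty N $ b = A -> elt (Ty N) Γ;
  refl : forall Γ, elt (Tm N) Γ -> elt (Tm N) Γ;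
  refl_ty : forall Γ (A : elt (Ty N) Γ) (a : elt (Tm N) Γ)
      (Ha : ty N $ a = A), ty N $ refl a = Id Ha Ha;
  Id_subst : forall Δ Γ (σ : hom Δ Γ) (A : elt (Ty N) Γ) (a b : elt (Tm N) Γ)
      (Ha : ty N $ a = A) (Hb : ty N $ b = A)
      (Ha' : ty N $ a.[σ] = A.[σ]) (Hb' : ty N $ b.[σ] = A.[σ]),
    (Id Ha Hb).[σ] = Id Ha' Hb';
  refl_subst : forall Δ Γ (σ : hom Δ Γ) (a : elt (Tm N) Γ),
    (refl a).[σ] = refl a.[σ]
}.
Arguments Id {C N} i {Γ A a b} Ha Hb : rename.
Arguments refl {C N} i {Γ} a : rename.

Section IdFamily.
Context {C : category} {N : natural_model C} (I : id_former N).

(* [Γ.A.A] and its generic identity type between the last two variables. *)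
Definition double_ext (Γ : C) (A : elt (Ty N) Γ) : C :=
  ext N A.[proj N A].

Definition double_ty (Γ : C) (A : elt (Ty N) Γ) : elt (Ty N) (double_ext A) :=
  A.[proj N A].[proj N A.[proj N A]].

Lemma fst_var_ty (Γ : C) (A : elt (Ty N) Γ) :
  ty N $ (var N A).[proj N A.[proj N A]] = double_ty A.
Proof. by rewrite papp_subst var_ty. Qed.

Lemma snd_var_ty (Γ : C) (A : elt (Ty N) Γ) :
  ty N $ var N A.[proj N A] = double_ty A.
Proof. by rewrite var_ty. Qed.

Definition generic_id (Γ : C) (A : elt (Ty N) Γ) : elt (Ty N) (double_ext A) :=
  Id I (fst_var_ty A) (snd_var_ty A).

Lemma Id_congr (Γ : C) (A A' : elt (Ty N) Γ) (a a' b b' : elt (Tm N) Γ)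
    (Ha : ty N $ a = A) (Hb : ty N $ b = A)
    (Ha' : ty N $ a' = A') (Hb' : ty N $ b' = A') :
  a = a' -> b = b' -> Id I Ha Hb = Id I Ha' Hb'.
Proof.
move=> ea eb; case: a' / ea Ha' => Ha'; case: b' / eb Hb' => Hb'.
have eA : A = A' by rewrite -Ha Ha'.
case: A' / eA Ha' Hb' => Ha' Hb'.
by rewrite (proof_irrelevance _ Ha Ha') (proof_irrelevance _ Hb Hb').
Qed.

Lemma Id_substE (Δ Γ : C) (σ : hom Δ Γ) (A : elt (Ty N) Γ) (A' : elt (Ty N) Δ)
    (a b : elt (Tm N) Γ) (a' b' : elt (Tm N) Δ)
    (Ha : ty N $ a = A) (Hb : ty N $ b = A)
    (Ha' : ty N $ a' = A') (Hb' : ty N $ b' = A') :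
  a' = a.[σ] -> b' = b.[σ] -> Id I Ha' Hb' = (Id I Ha Hb).[σ].
Proof.
move=> ea eb.
have Has : ty N $ a.[σ] = A.[σ] by rewrite papp_subst Ha.
have Hbs : ty N $ b.[σ] = A.[σ] by rewrite papp_subst Hb.
by rewrite (Id_subst I Ha Hb Has Hbs); apply: Id_congr.
Qed.

Definition diagonal (Γ : C) (A : elt (Ty N) Γ) : hom (ext N A) (double_ext A) :=
  inst N (var_ty N A).

Lemma refl_var_ty (Γ : C) (A : elt (Ty N) Γ) :
  ty N $ refl I (var N A) = (generic_id A).[diagonal A].
Proof.
rewrite (refl_ty I (erefl _)); apply: Id_substE.
  by rewrite subst_comp proj_inst subst_id.
by rewrite var_inst.
Qed.

(* [Γ.A -> Γ.A.A.Id] *)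
Definition id_inc (Γ : C) (A : elt (Ty N) Γ) :
  hom (ext N A) (ext N (generic_id A)) := pairing N (refl_var_ty A).

Lemma double_lift_ty (Δ Γ : C) (σ : hom Δ Γ) (A : elt (Ty N) Γ) :
  A.[σ].[proj N A.[σ]] = A.[proj N A].[lift N (erefl A.[σ])].
Proof. by rewrite !subst_comp proj_lift. Qed.

Definition double_lift (Δ Γ : C) (σ : hom Δ Γ) (A : elt (Ty N) Γ) :
  hom (double_ext A.[σ]) (double_ext A) := lift N (double_lift_ty σ A).

Lemma generic_id_subst (Δ Γ : C) (σ : hom Δ Γ) (A : elt (Ty N) Γ) :
  generic_id A.[σ] = (generic_id A).[double_lift σ A].
Proof.
apply: Id_substE; last by rewrite var_lift.
by rewrite (subst_comp (var N A)) proj_lift -(subst_comp (var N A)) var_lift.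
Qed.

Definition id_lift (Δ Γ : C) (σ : hom Δ Γ) (A : elt (Ty N) Γ) :
  hom (ext N (generic_id A.[σ])) (ext N (generic_id A)) :=
  lift N (generic_id_subst σ A).

Lemma id_inc_natural (Δ Γ : C) (σ : hom Δ Γ) (A : elt (Ty N) Γ) :
  id_lift σ A ∘ id_inc A.[σ] = id_inc A ∘ lift N (erefl A.[σ]).
Proof.
apply: ext_inj; last first.
  by rewrite -!subst_comp var_lift !var_pairing refl_subst var_lift.
rewrite !compA proj_lift proj_pairing -compA proj_pairing.
apply: ext_inj; last by rewrite -!subst_comp var_lift !var_inst var_lift.
by rewrite !compA proj_lift proj_inst comp1c -compA proj_inst compc1.
Qed.

Definition id_family : stable_family C :=
  {| index := Ty N;
     dom := fun Γ A => ext N A;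
     cod := fun Γ A => ext N (generic_id A);
     inc := id_inc;
     dom_map := fun Δ Γ σ A => lift N (erefl A.[σ]);
     cod_map := id_lift;
     inc_natural := id_inc_natural |}.

End IdFamily.

Record id_structure (C : category) (N : natural_model C) := IdStructure {
  idf :> id_former N;
  id_elim : elim_structure (id_family idf) N
}.

Record bool_structure (C : category) (N : natural_model C) := BoolStructure {
  Bool : forall Γ, elt (Ty N) Γ;
  btrue : forall Γ, elt (Tm N) Γ;
  bfalse : forall Γ, elt (Tm N) Γ;
  btrue_ty : forall Γ, ty N $ btrue Γ = Bool Γ;
  bfalse_ty : forall Γ, ty N $ bfalse Γ = Bool Γ;
  Bool_subst : forall Δ Γ (σ : hom Δ Γ), Bool Δ = (Bool Γ).[σ];
  btrue_subst : forall Δ Γ (σ : hom Δ Γ), btrue Δ = (btrue Γ).[σ];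
  bfalse_subst : forall Δ Γ (σ : hom Δ Γ), bfalse Δ = (bfalse Γ).[σ];
  bool_elim : forall Γ (B : elt (Ty N) (ext N (Bool Γ))) (t f : elt (Tm N) Γ),
    ty N $ t = B.[inst N (btrue_ty Γ)] -> ty N $ f = B.[inst N (bfalse_ty Γ)] ->
    elt (Tm N) (ext N (Bool Γ));
  bool_elim_ty : forall Γ (B : elt (Ty N) (ext N (Bool Γ)))
      (t f : elt (Tm N) Γ) (Ht : ty N $ t = B.[inst N (btrue_ty Γ)])
      (Hf : ty N $ f = B.[inst N (bfalse_ty Γ)]),
    ty N $ bool_elim Ht Hf = B;
  bool_elim_true : forall Γ (B : elt (Ty N) (ext N (Bool Γ)))
      (t f : elt (Tm N) Γ) (Ht : ty N $ t = B.[inst N (btrue_ty Γ)])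
      (Hf : ty N $ f = B.[inst N (bfalse_ty Γ)]),
    (bool_elim Ht Hf).[inst N (btrue_ty Γ)] = t;
  bool_elim_false : forall Γ (B : elt (Ty N) (ext N (Bool Γ)))
      (t f : elt (Tm N) Γ) (Ht : ty N $ t = B.[inst N (btrue_ty Γ)])
      (Hf : ty N $ f = B.[inst N (bfalse_ty Γ)]),
    (bool_elim Ht Hf).[inst N (bfalse_ty Γ)] = f;
  bool_elim_subst : forall Δ Γ (σ : hom Δ Γ)
      (B : elt (Ty N) (ext N (Bool Γ))) (t f : elt (Tm N) Γ)
      (Ht : ty N $ t = B.[inst N (btrue_ty Γ)])
      (Hf : ty N $ f = B.[inst N (bfalse_ty Γ)])
      (Ht' : ty N $ t.[σ] = B.[lift N (Bool_subst σ)].[inst N (btrue_ty Δ)])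
      (Hf' : ty N $ f.[σ] = B.[lift N (Bool_subst σ)].[inst N (bfalse_ty Δ)]),
    (bool_elim Ht Hf).[lift N (Bool_subst σ)] = bool_elim Ht' Hf'
}.
Arguments Bool {C N} b Γ : rename.

(* A universe à la Coquand: [Small] is the presheaf of small types, [El] its
   inclusion into all types, and [Code] identifies small types with the terms
   of the universe. *)
Record universe (C : category) (N : natural_model C) := Universe {
  Univ : forall Γ, elt (Ty N) Γ;
  Univ_subst : forall Δ Γ (σ : hom Δ Γ), (Univ Γ).[σ] = Univ Δ;
  Small : presheaf C;
  El : nattrans Small (Ty N);
  Code : nattrans Small (Tm N);
  Code_ty : forall Γ (A : elt Small Γ), ty N $ Code $ A = Univ Γ;
  Code_pullback : forall Γ (u : elt (Tm N) Γ),
    ty N $ u = Univ Γ -> exists! A, Code $ A = u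
}.

Lemma small_lift_ty (C : category) (S Y : presheaf C) (s : nattrans S Y)
    (Δ Γ : C) (σ : hom Δ Γ) (A : elt S Γ) :
  s $ A.[σ] = (s $ A).[σ].
Proof. exact: papp_subst. Qed.

(* Closure of a universe under a binder-like former [F] (a dependent product or
   sum) whose domains range over small types [S], decoded by [s]. *)
Record small_binder (C : category) (X Y : presheaf C) (f : nattrans X Y)
  (r : representable f) (S : presheaf C) (s : nattrans S Y)
  (N : natural_model C) (V : universe N)
  (F : forall Γ (A : elt Y Γ), elt (Ty N) (ext r A) -> elt (Ty N) Γ) :=
SmallBinder {
  sbind : forall Γ (A : elt S Γ),
    elt (Small V) (ext r (s $ A)) -> elt (Small V) Γ;
  sbind_El : forall Γ (A : elt S Γ) (B : elt (Small V) (ext r (s $ A))),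
    El V $ sbind B = F Γ (s $ A) (El V $ B);
  sbind_subst : forall Δ Γ (σ : hom Δ Γ) (A : elt S Γ)
      (B : elt (Small V) (ext r (s $ A))),
    (sbind B).[σ] = sbind B.[lift r (small_lift_ty s σ A)]
}.

Arguments small_binder {C X Y f} r {S} s {N} V F : rename.

Record small_id (C : category) (N : natural_model C) (V : universe N)
  (I : id_former N) := SmallId {
  sId : forall Γ (A : elt (Small V) Γ) (a b : elt (Tm N) Γ),
    ty N $ a = El V $ A -> ty N $ b = El V $ A -> elt (Small V) Γ;
  sId_El : forall Γ (A : elt (Small V) Γ) (a b : elt (Tm N) Γ)
      (Ha : ty N $ a = El V $ A) (Hb : ty N $ b = El V $ A),
    El V $ sId Ha Hb = Id I Ha Hb;
  sId_subst : forall Δ Γ (σ : hom Δ Γ) (A : elt (Small V) Γ)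
      (a b : elt (Tm N) Γ)
      (Ha : ty N $ a = El V $ A) (Hb : ty N $ b = El V $ A)
      (Ha' : ty N $ a.[σ] = El V $ A.[σ]) (Hb' : ty N $ b.[σ] = El V $ A.[σ]),
    (sId Ha Hb).[σ] = sId Ha' Hb'
}.

Record small_bool (C : category) (N : natural_model C) (V : universe N)
  (B : bool_structure N) := SmallBool {
  sBool : forall Γ, elt (Small V) Γ;
  sBool_El : forall Γ, El V $ sBool Γ = Bool B Γ;
  sBool_subst : forall Δ Γ (σ : hom Δ Γ), (sBool Γ).[σ] = sBool Δ
}.

Record modal_context_structure (M : two_category) := ModalContextStructure {
  ctx_functor :> strict_functor (coop M) CAT;
  empty_ctx : forall m : M, terminal_object (ctx_functor m)
}.

Definition ctx (M : two_category) (X : modal_context_structure M) (m : M) :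
  category := ctx_functor X m.

(* A modality [μ : n -> m] is interpreted by its lock, from contexts in mode [m]
   to contexts in mode [n]. *)
Definition lock (M : two_category) (X : modal_context_structure M) (m n : M)
  (μ : Hom n m) : functor (ctx X m) (ctx X n) :=
  @sf1 (coop M) CAT (ctx_functor X) m n μ.
Arguments lock {M} X {m n} μ.

(* The identity [Γ.{ν}.{μ} = Γ.{ν ∘ μ}], as a natural transformation. *)
Definition lock_comp (M : two_category) (X : modal_context_structure M)
  (m n o : M) (ν : Hom m o) (μ : Hom n m) :
  nattrans (functor_comp (lock X μ) (lock X ν)) (lock X (ν ⊚ μ)) :=
  @hom_of_eq (functor_category (ctx X o) (ctx X n))
    (functor_comp (lock X μ) (lock X ν)) (lock X (ν ⊚ μ))
    (esym (@sf_comp1 (coop M) CAT (ctx_functor X) o m n μ ν)).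

(* Besides the natural model of each mode, contexts can be extended by variables
   [x : (μ | A)] with [A] a type in the locked context [Γ.{μ}]. *)
Record modal_natural_model (M : two_category) := ModalNaturalModel {
  mcs :> modal_context_structure M;
  nm : forall m : M, natural_model (ctx mcs m);
  mext : forall (m n : M) (μ : Hom n m),
    representable (reindex_nt (lock mcs μ) (ty (nm n)))
}.
Arguments nm {M} X m : rename.
Arguments mext {M} X {m n} μ : rename.

(* Formation and introduction for [⟨μ | A⟩] only: pattern matching is framed by a
   further modality [ν], see [mod_family]. *)
Record modal_former (M : two_category) (X : modal_natural_model M) (m n : M)
  (μ : Hom n m) := ModalFormer {
  Mod : nattrans (reindex (lock X μ) (Ty (nm X n))) (Ty (nm X m));
  mk : nattrans (reindex (lock X μ) (Tm (nm X n))) (Tm (nm X m));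
  mk_ty : forall (Γ : ctx X m) (a : elt (Tm (nm X n)) (lock X μ Γ)),
    ty (nm X m) $ papp mk (Γ := Γ) a = papp Mod (Γ := Γ) (ty (nm X n) $ a)
}.

Definition reindex_along (C D E : category) (K : functor C D) (H : functor D E)
  (L : functor C E) (κ : nattrans (functor_comp H K) L) (P : presheaf E) :
  nattrans (reindex L P) (reindex K (reindex H P)).
Proof.
refine (@Nattrans _ _ (reindex L P) (reindex K (reindex H P))
          (fun Γ (x : elt P (L Γ)) => x.[ncomp κ Γ]) _).
move=> Γ Δ σ /=; apply: functional_extensionality => x.
have := subst_comp x (ncomp κ Γ) (fmor H (fmor K σ)).
have /= <- := natural κ σ; rewrite -subst_comp.
exact.
Defined.

(* The family of comparison maps [Γ.A -> Γ.(t A)] induced by a commutative square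
   between two representable natural transformations. *)
Section ComparisonFamily.
Context {C : category} {X Y X' Y' : presheaf C}.
Context {f : nattrans X Y} {f' : nattrans X' Y'}.
Context (r : representable f) (r' : representable f').
Context (u : nattrans X X') (t : nattrans Y Y').
Context (square : forall (Γ : C) (x : elt X Γ), f' $ u $ x = t $ f $ x).

Lemma comparison_ty (Γ : C) (y : elt Y Γ) :
  f' $ u $ var r y = (t $ y).[proj r y].
Proof. by rewrite square var_ty papp_subst. Qed.

Definition comparison (Γ : C) (y : elt Y Γ) : hom (ext r y) (ext r' (t $ y)) :=
  pairing r' (comparison_ty y).

Lemma comparison_natural (Δ Γ : C) (σ : hom Δ Γ) (y : elt Y Γ) :
  lift r' (papp_subst t y σ) ∘ comparison y.[σ]
  = comparison y ∘ lift r (erefl y.[σ]).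
Proof.
apply: ext_inj.
  by rewrite !compA proj_lift proj_pairing -compA proj_pairing proj_lift.
by rewrite -!subst_comp var_lift !var_pairing -papp_subst var_lift.
Qed.

Definition comparison_family : stable_family C :=
  {| index := Y;
     dom := fun Γ y => ext r y;
     cod := fun Γ y => ext r' (t $ y);
     inc := comparison;
     dom_map := fun Δ Γ σ y => lift r (erefl y.[σ]);
     cod_map := fun Δ Γ σ y => lift r' (papp_subst t y σ);
     inc_natural := comparison_natural |}.
End ComparisonFamily.

Section ModFamily.
Context {M : two_category} {X : modal_natural_model M}.
Context {m n o : M} (ν : Hom m o) (μ : Hom n m) (F : modal_former X μ).

(* [A] in mode [n] over [Γ.{ν ∘ μ}] is sent to [⟨μ | A⟩] over [Γ.{ν}], and
   similarly for terms. *)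
Definition framed_Mod :
  nattrans (reindex (lock X (ν ⊚ μ)) (Ty (nm X n)))
           (reindex (lock X ν) (Ty (nm X m))) :=
  nt_comp (reindex_nt (lock X ν) (Mod F))
          (reindex_along (lock_comp X ν μ) (Ty (nm X n))).

Definition framed_mk :
  nattrans (reindex (lock X (ν ⊚ μ)) (Tm (nm X n)))
           (reindex (lock X ν) (Tm (nm X m))) :=
  nt_comp (reindex_nt (lock X ν) (mk F))
          (reindex_along (lock_comp X ν μ) (Tm (nm X n))).

Lemma framed_square (Γ : ctx X o)
    (a : elt (reindex (lock X (ν ⊚ μ)) (Tm (nm X n))) Γ) :
  reindex_nt (lock X ν) (ty (nm X m)) $ framed_mk $ a
  = framed_Mod $ reindex_nt (lock X (ν ⊚ μ)) (ty (nm X n)) $ a.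
Proof.
have := mk_ty F (a : elt (Tm (nm X n)) _).[ncomp (lock_comp X ν μ) Γ].
by rewrite papp_subst.
Qed.

(* [Γ.(ν ∘ μ | A) -> Γ.(ν | ⟨μ | A⟩)] *)
Definition mod_family : stable_family (ctx X o) :=
  comparison_family (mext X (ν ⊚ μ)) (mext X ν) framed_square.
End ModFamily.

Record mtt_model (M : two_category) := MTTModel {
  mnm :> modal_natural_model M;
  m_pi : forall (m n : M) (μ : Hom n m), pi_structure (mext mnm μ) (nm mnm m);
  m_sigma : forall m : M, sigma_structure (nm mnm m);
  m_id : forall m : M, id_structure (nm mnm m);
  m_bool : forall m : M, bool_structure (nm mnm m);
  m_mod : forall (m n : M) (μ : Hom n m), modal_former mnm μ;
  m_mod_elim : forall (m n o : M) (ν : Hom m o) (μ : Hom n m),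
    elim_structure (mod_family ν (m_mod μ)) (nm mnm o);
  m_univ : forall m : M, universe (nm mnm m);
  m_small_pi : forall (m n : M) (μ : Hom n m),
    small_binder (mext mnm μ) (reindex_nt (lock mnm μ) (El (m_univ n))) (m_univ m)
      (@Pi _ _ _ _ _ _ (m_pi μ));
  m_small_sigma : forall m : M,
    small_binder (cext (nm mnm m)) (El (m_univ m)) (m_univ m)
      (@Sigma _ _ (m_sigma m));
  m_small_id : forall m : M, small_id (m_univ m) (m_id m);
  m_small_bool : forall m : M, small_bool (m_univ m) (m_bool m);
  m_small_mod : forall (m n : M) (μ : Hom n m),
    nattrans (reindex (lock mnm μ) (Small (m_univ n))) (Small (m_univ m));
  m_small_mod_El : forall (m n : M) (μ : Hom n m) (Γ : ctx mnm m)
      (A : elt (reindex (lock mnm μ) (Small (m_univ n))) Γ),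
    El (m_univ m) $ m_small_mod μ $ A
    = Mod (m_mod μ) $ reindex_nt (lock mnm μ) (El (m_univ n)) $ A
}.
Arguments m_mod {M} X {m n} μ : rename.

Record dependent_right_adjoint (C D : category) (L : functor C D)
  (NC : natural_model C) (ND : natural_model D) := DependentRightAdjoint {
  dra_Ty : nattrans (reindex L (Ty ND)) (Ty NC);
  dra_Tm : nattrans (reindex L (Tm ND)) (Tm NC);
  dra_square : forall (Γ : C) (a : elt (reindex L (Tm ND)) Γ),
    ty NC $ dra_Tm $ a = dra_Ty $ reindex_nt L (ty ND) $ a;
  dra_pullback : forall (Γ : C) (A : elt (reindex L (Ty ND)) Γ)
      (b : elt (Tm NC) Γ),
    ty NC $ b = dra_Ty $ A ->
    exists! a, reindex_nt L (ty ND) $ a = A /\ dra_Tm $ a = b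
}.

Lemma weak_comparison_ty (C D : category) (R : functor D C)
    (ND : natural_model D) (NC : natural_model C)
    (rTy : nattrans (Ty ND) (reindex R (Ty NC)))
    (rTm : nattrans (Tm ND) (reindex R (Tm NC)))
    (square : forall (Δ : D) (a : elt (Tm ND) Δ),
       reindex_nt R (ty NC) $ rTm $ a = rTy $ ty ND $ a)
    (Δ : D) (A : elt (Ty ND) Δ) :
  ty NC $ (rTm $ var ND A : elt (Tm NC) (R (ext ND A)))
  = (rTy $ A : elt (Ty NC) (R Δ)).[fmor R (proj ND A)].
Proof.
have := square _ (var ND A); rewrite var_ty papp_subst.
exact.
Qed.

(* An extension of the functor [R] to a weak morphism of natural models: [R]
   acts on types and terms, and preserves context extension up to the canonical
   comparison isomorphism [R (Δ.A) ≅ (R Δ).(R A)]. *)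
Record weak_morphism (C D : category) (R : functor D C)
  (ND : natural_model D) (NC : natural_model C) := WeakMorphism {
  wm_Ty : nattrans (Ty ND) (reindex R (Ty NC));
  wm_Tm : nattrans (Tm ND) (reindex R (Tm NC));
  wm_square : forall (Δ : D) (a : elt (Tm ND) Δ),
    reindex_nt R (ty NC) $ wm_Tm $ a = wm_Ty $ ty ND $ a;
  wm_ext : forall (Δ : D) (A : elt (Ty ND) Δ),
    is_iso (pairing NC (weak_comparison_ty wm_square A))
}.

(* The lift of a right adjoint [R] of [L] to a dependent right adjoint: types
   [A] over [L Γ] are sent to [(R A)[η]], with [η] the component at [Γ] of the unit,
   and terms likewise. *)
Section LiftedDRA.
Context {C D : category} {L : functor C D} {R : functor D C}.
Context {NC : natural_model C} {ND : natural_model D}.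
Context (adj : adjunction L R) (W : weak_morphism R ND NC).

Definition unit_restrict (P : presheaf C) :
  nattrans (reindex L (reindex R P)) P.
Proof.
refine (@Nattrans _ _ (reindex L (reindex R P)) P
          (fun Γ (x : elt P (R (L Γ))) => x.[ncomp (adj_unit adj) Γ]) _).
move=> Γ Δ σ /=; apply: functional_extensionality => x.
have := subst_comp x (ncomp (adj_unit adj) Γ) σ.
have /= <- := natural (adj_unit adj) σ; rewrite -subst_comp.
exact.
Defined.

Definition lift_Ty : nattrans (reindex L (Ty ND)) (Ty NC) :=
  nt_comp (unit_restrict (Ty NC)) (reindex_nt L (wm_Ty W)).

Definition lift_Tm : nattrans (reindex L (Tm ND)) (Tm NC) :=
  nt_comp (unit_restrict (Tm NC)) (reindex_nt L (wm_Tm W)).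

Lemma lift_square (Γ : C) (a : elt (reindex L (Tm ND)) Γ) :
  ty NC $ lift_Tm $ a = lift_Ty $ reindex_nt L (ty ND) $ a.
Proof.
have e := papp_subst (ty NC)
  (wm_Tm W $ (a : elt (Tm ND) (L Γ)) : elt (Tm NC) (R (L Γ))) (adj_unit adj Γ).
apply: etrans e _.
exact: (f_equal (fun A : elt (Ty NC) (R (L Γ)) => A.[adj_unit adj Γ])
          (wm_square W (a : elt (Tm ND) (L Γ)))).
Qed.

Definition transpose (Γ : C) (Δ : D) (h : hom Γ (R Δ)) : hom (L Γ) Δ :=
  adj_counit adj Δ ∘ fmor L h.

Lemma transposeK (Γ : C) (Δ : D) (h : hom Γ (R Δ)) :
  fmor R (transpose h) ∘ adj_unit adj Γ = h.
Proof.
rewrite /transpose fmor_comp -compA.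
have /= -> := natural (adj_unit adj) h.
by rewrite compA triangle_right comp1c.
Qed.

Lemma untransposeK (Γ : C) (Δ : D) (k : hom (L Γ) Δ) :
  transpose (fmor R k ∘ adj_unit adj Γ) = k.
Proof.
rewrite /transpose fmor_comp compA.
have /= <- := natural (adj_counit adj) k.
by rewrite -compA triangle_left compc1.
Qed.

Lemma wm_Tm_subst (Δ Δ' : D) (a : elt (Tm ND) Δ) (σ : hom Δ' Δ) :
  (wm_Tm W $ a.[σ] : elt (Tm NC) (R Δ'))
  = (wm_Tm W $ a : elt (Tm NC) (R Δ)).[fmor R σ].
Proof. exact: (papp_subst (wm_Tm W) a σ). Qed.

Lemma lift_pullback (Γ : C) (A : elt (reindex L (Ty ND)) Γ)
    (b : elt (Tm NC) Γ) :
  ty NC $ b = lift_Ty $ A ->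
  exists! a, reindex_nt L (ty ND) $ a = A /\ lift_Tm $ a = b.
Proof.
change (elt (Ty ND) (L Γ)) in A => Hb0.
pose RA : elt (Ty NC) (R (L Γ)) := wm_Ty W $ A.
have Hb : ty NC $ b = RA.[adj_unit adj Γ] := Hb0.
have [inv [inv1 cmpK]] := wm_ext W A.
set cmp := pairing NC _ in inv1 cmpK.
pose h := inv ∘ pairing NC Hb.
have proj_cmp : proj NC RA ∘ cmp = fmor R (proj ND A) by exact: proj_pairing.
have var_cmp : (var NC RA).[cmp] = wm_Tm W $ var ND A by exact: var_pairing.
have cmp_h : cmp ∘ h = pairing NC Hb by rewrite /h compA cmpK comp1c.
have tr_inj Δ (k k' : hom (L Γ) Δ) :
  fmor R k ∘ adj_unit adj Γ = fmor R k' ∘ adj_unit adj Γ -> k = k'.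
  by move=> e; rewrite -(untransposeK k) e untransposeK.
have proj_k : proj ND A ∘ transpose h = idc (L Γ).
  apply: tr_inj; rewrite fmor_comp -compA transposeK fmor_id comp1c.
  by rewrite -proj_cmp -compA cmp_h proj_pairing.
exists ((var ND A).[transpose h]); split; first split.
- change (ty ND $ (var ND A).[transpose h] = A).
  by rewrite papp_subst var_ty subst_comp proj_k subst_id.
- change ((wm_Tm W $ (var ND A).[transpose h] : elt (Tm NC) (R (L Γ)))
            .[adj_unit adj Γ] = b).
  rewrite wm_Tm_subst subst_comp transposeK -var_cmp subst_comp cmp_h.
  exact: var_pairing.
- move=> a' [Ha' Hb'].
change (elt (Tm ND) (L Γ)) in a'; change (ty ND $ a' = A) in Ha'.
have {}Hb' : (wm_Tm W $ a' : elt (Tm NC) (R (L Γ))).[adj_unit adj Γ] = b := Hb'.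
pose k' := inst ND Ha'.
have -> : a' = (var ND A).[k'] by rewrite /k' var_inst.
suff -> : k' = transpose h by [].
apply: tr_inj; rewrite transposeK.
rewrite -[LHS]comp1c -inv1 -compA /h; congr (_ ∘ _).
apply: ext_inj.
  rewrite proj_pairing !compA proj_cmp -fmor_comp /k' proj_inst fmor_id.
  by rewrite comp1c.
rewrite var_pairing -subst_comp var_cmp -subst_comp.
by rewrite -wm_Tm_subst /k' var_inst.
Qed.

Definition lifted_dra : dependent_right_adjoint L NC ND :=
  {| dra_Ty := lift_Ty;
     dra_Tm := lift_Tm;
     dra_square := lift_square;
     dra_pullback := lift_pullback |}.

End LiftedDRA.

(* The formation and introduction operations of [⟨μ | -⟩] are those of a
   dependent right adjoint.  Nothing has to be said about the eliminators: as
   the introduction square of a dependent right adjoint is a pullback, they are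
   determined by their computation rule. *)
Definition interpreted_by (M : two_category) (X : modal_natural_model M)
  (m n : M) (μ : Hom n m) (F : modal_former X μ)
  (d : dependent_right_adjoint (lock X μ) (nm X m) (nm X n)) : Prop :=
  Mod F = dra_Ty d /\ mk F = dra_Tm d.

(* Main.v *)
(* A strict 2-functor preserves adjunctions between 1-cells, and reversing
   2-cells exchanges the unit [η] with the counit while reversing 1-cells
   exchanges the two adjoints back: hence [lock ν ⊣ lock μ].  If moreover
   [lock ν ⊣ Rν] and [lock μ ⊣ Rμ], then [lock μ ≅ Rν] since both are right
   adjoint to [lock ν], so that [lock μ ⊣ Rμ] gives [Rν ⊣ Rμ]. *)
From Stdlib Require Import ssreflect ssrfun ProofIrrelevance.
Require Import Defs.

Set Implicit Arguments.
Unset Strict Implicit.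
Unset Printing Implicit Defensive.

Local Open Scope cat_scope.

(** * Calculus of transports along equalities of objects *)

Lemma hom_of_eq_comp (C : category) (a b c : C) (e : a = b) (e' : b = c) :
  hom_of_eq e' ∘ hom_of_eq e = hom_of_eq (etrans e e').
Proof. by case: c / e'; rewrite comp1c. Qed.

Lemma fmor_hom_of_eq (C D : category) (F : functor C D) (a b : C) (e : a = b) :
  fmor F (hom_of_eq e) = hom_of_eq (f_equal (fob F) e).
Proof. by case: b / e; rewrite fmor_id. Qed.

Lemma hom_of_eqK (C : category) (a b c : C) (e : a = b) (e' : b = a)
    (f : hom c a) : hom_of_eq e' ∘ (hom_of_eq e ∘ f) = f.
Proof. by rewrite compA hom_of_eq_comp hom_of_eq_id comp1c. Qed.

(** Once the outer equalities are eliminated, the remaining ones are parallel and agree by proof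
    irrelevance. This carries a triangle between locks of composite modalities to one between
    composites of lock functors. *)
Lemma hom_of_eq_sandwich (C : category) (x y z w u u' v v' : C) (g : hom x y)
    (f : hom z w) (p1 : y = u) (q1 : y = u') (p2 q2 : w = x) (p3 : v = z)
    (q3 : v' = z) (p4 : v = u) (q4 : v' = u') :
  hom_of_eq p1 ∘ (g ∘ (hom_of_eq p2 ∘ (f ∘ hom_of_eq p3))) = hom_of_eq p4 ->
  hom_of_eq q1 ∘ (g ∘ (hom_of_eq q2 ∘ (f ∘ hom_of_eq q3))) = hom_of_eq q4.
Proof.
case: u / p1 p4 => p4; case: u' / q1 q4 => q4.
case: z / p3 f q3 => f q3; case: v / q3 f p4 => f p4.
by rewrite (proof_irrelevance _ p2 q2) (proof_irrelevance _ p4 q4).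
Qed.

(** * Locks on 2-cells, and adjunctions between modalities *)

Section LockCell.
Context {M : two_category} (X : modal_context_structure M).

(** The key substitution of [s], contravariant in 2-cells because of [coop]. *)
Definition lock_cell (m n : M) (f g : @Hom M n m) (s : hom f g) :
  nattrans (lock X g) (lock X f) :=
  fmor (@sf1 (coop M) CAT (ctx_functor X) m n)
    (s : @hom (op_category (@Hom M n m)) g f).

Definition lock_id1 (m : M) :
  nattrans (lock X (id1 m)) (functor_id (ctx X m)) :=
  @hom_of_eq (functor_category (ctx X m) (ctx X m)) _ _
    (@sf_id1 (coop M) CAT (ctx_functor X) m).

Definition lock_id1_inv (m : M) :
  nattrans (functor_id (ctx X m)) (lock X (id1 m)) :=
  @hom_of_eq (functor_category (ctx X m) (ctx X m)) _ _
    (esym (@sf_id1 (coop M) CAT (ctx_functor X) m)).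

Definition lock_comp_inv (m n o : M) (g : @Hom M m o) (f : @Hom M n m) :
  nattrans (lock X (g ⊚ f)) (functor_comp (lock X f) (lock X g)) :=
  @hom_of_eq (functor_category (ctx X o) (ctx X n))
    (lock X (g ⊚ f)) (functor_comp (lock X f) (lock X g))
    (@sf_comp1 (coop M) CAT (ctx_functor X) o m n f g).

Lemma lock_cell_comp (m n : M) (f g h : @Hom M n m) (t : hom g h)
    (s : hom f g) (Γ : ctx X m) :
  lock_cell (t ∘ s) Γ = lock_cell s Γ ∘ lock_cell t Γ.
Proof.
exact: (f_equal (fun u : nattrans (lock X h) (lock X f) => u Γ)
  (@fmor_comp _ _ (@sf1 (coop M) CAT (ctx_functor X) m n) h g f s t)).
Qed.

Lemma lock_cell_id (m n : M) (f : @Hom M n m) (Γ : ctx X m) :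
  lock_cell (idc f) Γ = idc (lock X f Γ).
Proof.
exact: (f_equal (fun u : nattrans (lock X f) (lock X f) => u Γ)
  (@fmor_id _ _ (@sf1 (coop M) CAT (ctx_functor X) m n) f)).
Qed.

Lemma lock_cell_hom_of_eq (m n : M) (f g : @Hom M n m) (e : f = g)
    (Γ : ctx X m) :
  lock_cell (hom_of_eq e) Γ
  = hom_of_eq (f_equal (fun h => lock X h Γ) (esym e)).
Proof. by case: g / e; rewrite lock_cell_id. Qed.

(** This is [sf_hcomp] at a component. The equalities stay existential, since [hom_of_eq_sandwich]
    accepts any of them. *)
Lemma lock_cell_hcomp (m n o : M) (g g' : @Hom M m o) (f f' : @Hom M n m)
    (t : hom g g') (s : hom f f') (Γ : ctx X o) :
  exists e e', lock_cell (hcomp t s) Γ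
  = hom_of_eq e ∘ (lock_cell s (lock X g Γ)
      ∘ fmor (lock X f') (lock_cell t Γ)) ∘ hom_of_eq e'.
Proof.
have /(f_equal (fun u : nattrans (lock X (g' ⊚ f'))
    (functor_comp (lock X f) (lock X g)) => u Γ)) :=
  @sf_hcomp (coop M) CAT (ctx_functor X) o m n f' f g' g s t.
rewrite /= !ncomp_hom_of_eq.
set e0 := f_equal _ _; set e1 := f_equal _ _ => H.
exists (esym e0), e1; rewrite -compA.
have /= <- := H.
by rewrite hom_of_eqK.
Qed.

Section InternalAdjunction.
Context {m n : M} (ν : @Hom M m n) (μ : @Hom M n m).
Context (η : hom (id1 m) (μ ⊚ ν)) (ε : hom (ν ⊚ μ) (id1 n)).

Definition lock_counit :
  nattrans (functor_comp (lock X ν) (lock X μ)) (functor_id (ctx X m)) :=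
  nt_comp (lock_id1 m) (nt_comp (lock_cell η) (lock_comp X μ ν)).

Definition lock_unit :
  nattrans (functor_id (ctx X n)) (functor_comp (lock X μ) (lock X ν)) :=
  nt_comp (lock_comp_inv ν μ) (nt_comp (lock_cell ε) (lock_id1_inv n)).

Lemma lock_counitE (Γ : ctx X m) : exists e e',
  lock_counit Γ = hom_of_eq e ∘ lock_cell η Γ ∘ hom_of_eq e'.
Proof.
rewrite /= /lock_id1 /lock_comp !ncomp_hom_of_eq.
by eexists _, _; rewrite -compA.
Qed.

Lemma lock_unitE (Γ : ctx X n) : exists e e',
  lock_unit Γ = hom_of_eq e ∘ lock_cell ε Γ ∘ hom_of_eq e'.
Proof.
rewrite /= /lock_id1_inv /lock_comp_inv !ncomp_hom_of_eq.
by eexists _, _; rewrite -compA.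
Qed.

(** The hypothesis allows any [hom_of_eq e] because [ν ⊚ id1 m] and [id1 n ⊚ ν] are only
    propositionally equal. Reversal of 2-cells puts the image of [ε] first and that of [η] last, as
    the left triangle requires. *)
Lemma lock_triangle_left
    (triangle : exists e, hcomp ε (idc ν) ∘ hom_of_eq (comp1A ν μ ν)
       ∘ hcomp (idc ν) η = hom_of_eq e) (Γ : ctx X n) :
  lock_counit (lock X ν Γ) ∘ fmor (lock X ν) (lock_unit Γ) = idc (lock X ν Γ).
Proof.
case: triangle => e0 /(f_equal (fun s => lock_cell s Γ)).
have [e1 [e2 ->]] := lock_counitE (lock X ν Γ).
have [e3 [e4 ->]] := lock_unitE Γ.
rewrite !lock_cell_comp !lock_cell_hom_of_eq.
have [e5 [e6 ->]] := lock_cell_hcomp (idc ν) η Γ.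
have [e7 [e8 ->]] := lock_cell_hcomp ε (idc ν) Γ.
rewrite !lock_cell_id !fmor_id !fmor_comp !fmor_hom_of_eq comp1c compc1.
(* Fusing neighbouring transports brings the image of the triangle and the goal to the alternating
   shape of [hom_of_eq_sandwich]. *)
rewrite -!compA; do 2!rewrite !(compA (hom_of_eq _) (hom_of_eq _)) !hom_of_eq_comp.
move=> H; apply: etrans (hom_of_eq_id erefl); exact: hom_of_eq_sandwich H.
Qed.

Lemma lock_triangle_right
    (triangle : exists e, hcomp (idc μ) ε ∘ hom_of_eq (esym (comp1A μ ν μ))
       ∘ hcomp η (idc μ) = hom_of_eq e) (Γ : ctx X m) :
  fmor (lock X μ) (lock_counit Γ) ∘ lock_unit (lock X μ Γ) = idc (lock X μ Γ).
Proof.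
case: triangle => e0 /(f_equal (fun s => lock_cell s Γ)).
have [e1 [e2 ->]] := lock_counitE Γ.
have [e3 [e4 ->]] := lock_unitE (lock X μ Γ).
rewrite !lock_cell_comp !lock_cell_hom_of_eq.
have [e5 [e6 ->]] := lock_cell_hcomp η (idc μ) Γ.
have [e7 [e8 ->]] := lock_cell_hcomp (idc μ) ε Γ.
rewrite !lock_cell_id !fmor_id !fmor_comp !fmor_hom_of_eq comp1c compc1.
rewrite -!compA; do 2!rewrite !(compA (hom_of_eq _) (hom_of_eq _)) !hom_of_eq_comp.
move=> H; apply: etrans (hom_of_eq_id erefl); exact: hom_of_eq_sandwich H.
Qed.

End InternalAdjunction.
End LockCell.

(** * The generating adjunction and its image under the locks *)

Definition eta_cell : @hom (@Hom walking_adjunction mode_m mode_m)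
    (id1 _) (adj_mu ⊚ adj_nu) := adj_class adj_eta.

Definition epsilon_cell : @hom (@Hom walking_adjunction mode_n mode_n)
    (adj_nu ⊚ adj_mu) (id1 _) := adj_class adj_epsilon.

(** On closed paths both bracketings compute to the same path, so the associator is an identity and
    the generating relation applies directly. *)
Lemma triangle_nu : exists e,
  hcomp epsilon_cell (idc adj_nu) ∘ hom_of_eq (comp1A adj_nu adj_mu adj_nu)
    ∘ hcomp (idc adj_nu) eta_cell = hom_of_eq e.
Proof.
exists erefl; rewrite hom_of_eq_id compc1.
rewrite /= /adj_cell_id !adj_hcomp_class adj_vcomp_class.
exact: adj_class_eq eqv_triangle_nu.
Qed.

Lemma triangle_mu : exists e,
  hcomp (idc adj_mu) epsilon_cell
    ∘ hom_of_eq (esym (comp1A adj_mu adj_nu adj_mu))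
    ∘ hcomp eta_cell (idc adj_mu) = hom_of_eq e.
Proof.
exists erefl; rewrite hom_of_eq_id compc1.
rewrite /= /adj_cell_id !adj_hcomp_class adj_vcomp_class.
exact: adj_class_eq eqv_triangle_mu.
Qed.

Definition lock_adjunction (X : modal_context_structure walking_adjunction) :
  adjunction (lock X adj_nu) (lock X adj_mu) :=
  Adjunction (lock_triangle_left triangle_nu)
    (lock_triangle_right triangle_mu).

(** * Uniqueness of right adjoints and transport of adjunctions *)

Section RightAdjointUnique.
Context {C D : category} {L : functor C D} {R R' : functor D C}.
Context (A : adjunction L R) (A' : adjunction L R').

(** The canonical comparison: the transpose under [A'] of the counit of [A]. *)
Definition right_adjoint_map : nattrans R R'.
Proof.
refine (@Nattrans D C R R'
  (fun d => fmor R' (adj_counit A d) ∘ adj_unit A' (R d)) _).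
move=> a b f; have /= nu := natural (adj_unit A') (fmor R f).
have /= nc := natural (adj_counit A) f.
by rewrite -compA -nu !compA -!fmor_comp nc.
Defined.

End RightAdjointUnique.

Lemma transpose_comp (C D : category) (L : functor C D) (R : functor D C)
    (A : adjunction L R) (Γ' Γ : C) (Δ : D) (h : hom Γ (R Δ)) (k : hom Γ' Γ) :
  transpose A (h ∘ k) = transpose A h ∘ fmor L k.
Proof. by rewrite /transpose fmor_comp compA. Qed.

Lemma transpose_right_adjoint_map (C D : category) (L : functor C D)
    (R R' : functor D C) (A : adjunction L R) (A' : adjunction L R') (d : D) :
  transpose A' (right_adjoint_map A A' d) = adj_counit A d.
Proof. exact: untransposeK. Qed.

(** By [transposeK] it suffices to compare transposes under [A], and both are the counit of [A]. *)
Lemma right_adjoint_mapK (C D : category) (L : functor C D)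
    (R R' : functor D C) (A : adjunction L R) (A' : adjunction L R') (d : D) :
  right_adjoint_map A' A d ∘ right_adjoint_map A A' d = idc (R d).
Proof.
rewrite -[LHS](transposeK A) -[RHS](transposeK A); congr (fmor R _ ∘ _).
rewrite transpose_comp transpose_right_adjoint_map.
(* The counit of [A'] after an image under [L] is again a transpose, now under [A']. *)
rewrite -/(transpose A' _) transpose_right_adjoint_map.
by rewrite /transpose fmor_id compc1.
Qed.

Definition adjunction_iso_left (C D : category) (L L' : functor C D)
  (R : functor D C) (s : nattrans L L') (s' : nattrans L' L)
  (sK : forall c, s' c ∘ s c = idc (L c))
  (s'K : forall c, s c ∘ s' c = idc (L' c)) (A : adjunction L R) :
  adjunction L' R.
Proof.
refine (@Adjunction C D L' R
  (nt_comp (nt_hcomp (nt_id R) s) (adj_unit A))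
  (nt_comp (adj_counit A) (nt_hcomp s' (nt_id R))) _ _).
(* Naturality moves [s'] to the right end and [s] to the left end, leaving the triangle of [A]
   between them. *)
- move=> c; rewrite /= comp1c fmor_id compc1 -compA -natural fmor_comp.
  have /= nc := natural (adj_counit A) (s c).
  by rewrite !compA -nc -(compA (s c)) triangle_left compc1 s'K.
- move=> d; rewrite /= comp1c fmor_id compc1.
  by rewrite compA -fmor_comp -compA sK compc1 triangle_right.
Defined.

Theorem theorem10p2 (X : mtt_model walking_adjunction) :
  inhabited (adjunction (lock X adj_nu) (lock X adj_mu)) /\
  forall (Rmu : functor (ctx X mode_n) (ctx X mode_m))
    (Rnu : functor (ctx X mode_m) (ctx X mode_n))
    (Amu : adjunction (lock X adj_mu) Rmu)
    (Anu : adjunction (lock X adj_nu) Rnu)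
    (Wmu : weak_morphism Rmu (nm X mode_n) (nm X mode_m))
    (Wnu : weak_morphism Rnu (nm X mode_m) (nm X mode_n)),
    interpreted_by (m_mod X adj_mu) (lifted_dra Amu Wmu) ->
    interpreted_by (m_mod X adj_nu) (lifted_dra Anu Wnu) ->
    inhabited (adjunction Rnu Rmu).
Proof.
split; first exact: inhabits (lock_adjunction X).
move=> Rmu Rnu Amu Anu _ _ _ _; apply: inhabits.
(* The two cancellation laws fix [s] and [s'] as the comparisons between [lock X adj_mu] and
   [Rnu]. *)
exact: adjunction_iso_left (right_adjoint_mapK (lock_adjunction X) Anu)
  (right_adjoint_mapK Anu (lock_adjunction X)) Amu.
Qed.
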